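(* For any epistemic theory $\Gamma$, every equilibrium world view of $\Gamma$ is also a G91-world view of $\Gamma$.
   Context: Fix a set $\mathrm{At}$ of atoms. Formulas: $\varphi ::= \bot \mid a \mid \varphi_1\wedge\varphi_2 \mid \varphi_1\vee\varphi_2\mid \varphi_1\to\varphi_2 \mid \mathbf{L}\varphi$; $\neg\varphi := \varphi\to\bot$, $\top:=\neg\bot$. A theory is a set of formulas. G91. A belief view $\mathcal W$ is a set of interpretations $I\subseteq\mathrm{At}$. $\langle\mathcal W,I\rangle\models\varphi$ is classical on $\bot,\wedge,\vee,\to$, with $\langle\mathcal W,I\rangle\models a$ iff $a\in I$ and $\langle\mathcal W,I\rangle\models\mathbf L\psi$ iff $\langle\mathcal W,J\rangle\models\psi$ for all $J\in\mathcal W$ (write $\mathcal W\models\mathbf L\psi$). The subjective reduct $\Gamma^{\mathcal W}$ replaces each maximal subformula $\mathbf L\psi$ by $\top$ if $\mathcal W\models\mathbf L\psi$, else by $\bot$. For $\mathbf L$-free formulas, HT satisfaction on pairs $\langle H,T\rangle$, $H\subseteq T$: $\not\models\bot$; $\models p$ iff $p\in H$; $\wedge,\vee$ componentwise; $\models\varphi\to\psi$ iff $T\models\varphi\to\psi$ classically and ($\not\models\varphi$ or $\models\psi$). $T$ is a stable model of $\Gamma$ iff $T\models\Gamma$ classically and no $H\subsetneq T$ has $\langle H,T\rangle\models\Gamma$; $\mathrm{SM}[\Gamma]$ is the set of stable models. $\mathcal W$ is a G91-world view of $\Gamma$ iff $\mathcal W=\mathrm{SM}[\Gamma^{\mathcal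 W}]$. FAEEL. HT belief views are non-empty sets $\mathcal W$ of pairs $\langle H_i,T_i\rangle$, $H_i\subseteq T_i\subseteq\mathrm{At}$; $\mathcal W^t=\{T_i\}$; total if all $H_i=T_i$ (identified with a set of interpretations). For $\mathcal I=\langle\mathcal W,H,T\rangle$ with $H\subseteq T$: $\mathcal I\not\models\bot$; $\mathcal I\models a$ iff $a\in H$; $\wedge,\vee$ componentwise; $\mathcal I\models\psi_1\to\psi_2$ iff ($\mathcal I\not\models\psi_1$ or $\mathcal I\models\psi_2$) and ($\langle\mathcal W^t,T,T\rangle\not\models\psi_1$ or $\langle\mathcal W^t,T,T\rangle\models\psi_2$); $\mathcal I\models\mathbf L\psi$ iff $\langle\mathcal W,H_i,T_i\rangle\models\psi$ for all $\langle H_i,T_i\rangle\in\mathcal W$. Belief model of $\Gamma$: $\langle\mathcal W,H_i,T_i\rangle\models\varphi$ for all $\varphi\in\Gamma$ and all $\langle H_i,T_i\rangle\in\mathcal W\cup\{\langle H,T\rangle\}$. $\langle\mathcal W',H',T'\rangle\preceq\langle\mathcal W,H,T\rangle$ iff $T'=T$, $H'\subseteq H$, every $\langle H_i,T_i\rangle\in\mathcal W$ has some $\langle H'_i,T_i\rangle\in\mathcal W'$ with $H'_i\subseteq H_i$, and every $\langle H'_i,T_i\rangle\in\mathcal W'$ has some $\langle H_i,T_i\rangle\in\mathcal W$ with $H'_i\subseteq H_i$; $\prec$ strict. A total $\langle\mathcal W,T,T\rangle$ is an equilibrium belief model of $\Gamma$ if it is a belief model and no belief model is $\prec$ it; $\mathrm{EQB}[\Gamma]$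 their set. A total belief view $\mathcal W$ is an equilibrium world view of $\Gamma$ iff $\mathcal W=\{T:\langle\mathcal W,T,T\rangle\in\mathrm{EQB}[\Gamma]\}$. *)

(* Defs.v *)
From mathcomp Require Import all_boot.
From mathcomp Require Import boolp classical_sets.

Set Implicit Arguments.
Unset Strict Implicit.
Unset Printing Implicit Defensive.

Local Open Scope classical_set_scope.

Section Epistemic.

Variable At : Type.

Inductive formula : Type :=
| Bot
| Atom of At
| And of formula & formula
| Or of formula & formula
| Imp of formula & formula
| L of formula.

Definition theory := set formula.

(* The L-free formulas; they have their own type so that classical and HT
   satisfaction need no value on L. *)
Inductive oformula : Type :=
| OBot
| OAtom of At
| OAnd of oformula & oformula
| OOr of oformula & oformula
| OImp of oformula & oformula.

Definition OTop : oformula := OImp OBot OBot.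

Definition otheory := set oformula.

Definition interp := set At.

Fixpoint g91_sat (W : set interp) (I : interp) (phi : formula) : Prop :=
  match phi with
  | Bot => False
  | Atom a => I a
  | And f g => g91_sat W I f /\ g91_sat W I g
  | Or f g => g91_sat W I f \/ g91_sat W I g
  | Imp f g => g91_sat W I f -> g91_sat W I g
  | L f => forall J, W J -> g91_sat W J f
  end.

Definition g91_believes (W : set interp) (psi : formula) : Prop :=
  forall J, W J -> g91_sat W J psi.

Fixpoint reduct (W : set interp) (phi : formula) : oformula :=
  match phi with
  | Bot => OBot
  | Atom a => OAtom a
  | And f g => OAnd (reduct W f) (reduct W g)
  | Or f g => OOr (reduct W f) (reduct W g)
  | Imp f g => OImp (reduct W f) (reduct W g)
  | L f => if `[< g91_believes W f >] then OTop else OBot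
  end.

Definition subjective_reduct (Gamma : theory) (W : set interp) : otheory :=
  [set reduct W phi | phi in Gamma].

Fixpoint classical_sat (T : interp) (phi : oformula) : Prop :=
  match phi with
  | OBot => False
  | OAtom a => T a
  | OAnd f g => classical_sat T f /\ classical_sat T g
  | OOr f g => classical_sat T f \/ classical_sat T g
  | OImp f g => classical_sat T f -> classical_sat T g
  end.

Fixpoint ht_sat (H T : interp) (phi : oformula) : Prop :=
  match phi with
  | OBot => False
  | OAtom a => H a
  | OAnd f g => ht_sat H T f /\ ht_sat H T g
  | OOr f g => ht_sat H T f \/ ht_sat H T g
  | OImp f g => classical_sat T (OImp f g) /\ (~ ht_sat H T f \/ ht_sat H T g)
  end.

Definition stable_models (Gamma : otheory) : set interp :=
  [set T | (forall phi, Gamma phi -> classical_sat T phi) /\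
           ~ exists H : interp, H `<` T /\
               forall phi, Gamma phi -> ht_sat H T phi].

Definition g91_world_view (Gamma : theory) (W : set interp) : Prop :=
  W = stable_models (subjective_reduct Gamma W).

(* A pair (H, T) stands for <H, T>; H `<=` T and non-emptiness of views are
   imposed by ht_belief_view and is_belief_interp. *)
Definition ht_view := set (interp * interp).

Definition ht_belief_view (W : ht_view) : Prop :=
  W !=set0 /\ forall p, W p -> p.1 `<=` p.2.

(* The identification of a set of interpretations with a total view. *)
Definition total_view (V : set interp) : ht_view := [set (T, T) | T in V].

Definition there_view (W : ht_view) : set interp := [set p.2 | p in W].

Fixpoint faeel_sat (phi : formula) (W : ht_view) (H T : interp) : Prop :=
  match phi with
  | Bot => False
  | Atom a => H a
  | And f g => faeel_sat f W H T /\ faeel_sat g W H T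
  | Or f g => faeel_sat f W H T \/ faeel_sat g W H T
  | Imp f g =>
      (~ faeel_sat f W H T \/ faeel_sat g W H T) /\
      (~ faeel_sat f (total_view (there_view W)) T T \/
       faeel_sat g (total_view (there_view W)) T T)
  | L f => forall p, W p -> faeel_sat f W p.1 p.2
  end.

Record belief_interp := BeliefInterp {
  view : ht_view;
  here : interp;
  there : interp }.

Definition is_belief_interp (I : belief_interp) : Prop :=
  ht_belief_view (view I) /\ here I `<=` there I.

Definition is_total (I : belief_interp) : Prop :=
  (forall p, view I p -> p.1 = p.2) /\ here I = there I.

Definition belief_model (Gamma : theory) (I : belief_interp) : Prop :=
  is_belief_interp I /\
  forall phi, Gamma phi ->
    forall p, (view I `|` [set (here I, there I)]) p ->
      faeel_sat phi (view I) p.1 p.2.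

Definition bi_le (I' I : belief_interp) : Prop :=
  [/\ there I' = there I,
      here I' `<=` here I,
      forall H T, view I (H, T) ->
        exists2 H', view I' (H', T) & H' `<=` H &
      forall H' T, view I' (H', T) ->
        exists2 H, view I (H, T) & H' `<=` H].

Definition bi_lt (I' I : belief_interp) : Prop := bi_le I' I /\ I' <> I.

Definition EQB (Gamma : theory) : set belief_interp :=
  [set I | [/\ is_total I, belief_model Gamma I &
               ~ exists I', belief_model Gamma I' /\ bi_lt I' I]].

Definition equilibrium_world_view (Gamma : theory) (W : set interp) : Prop :=
  ht_belief_view (total_view W) /\
  W = [set T | EQB Gamma (BeliefInterp (total_view W) T T)].

End Epistemic.

(* Main.v *)
(** On a total view [W], FAEEL satisfaction at [<H, T>] coincides with HT
    satisfaction of the subjective reduct with respect to [W].  Hence a proper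
    [H] refuting the stability of a world [T] of [W] also refutes minimality of
    [<W, T, T>], the view being kept fixed.  Conversely, if [T] is stable, a
    belief model strictly below [<W, T, T>] must change the view, since its here
    component cannot shrink while the view stays [W]; but a strictly smaller view
    would refute minimality of [<W, T0, T0>] for any world [T0] of the non-empty
    view [W]. *)

Require Import Defs.
From mathcomp Require Import all_boot.
From mathcomp Require Import boolp classical_sets.

Set Implicit Arguments.
Unset Strict Implicit.
Unset Printing Implicit Defensive.

Local Open Scope classical_set_scope.

Section ReductCorrespondence.

Variable At : Type.
Implicit Types (W : set (interp At)) (H T : interp At) (Gamma : theory At).

Lemma ht_sat_total T (f : oformula At) : ht_sat T T f <-> classical_sat T f.
Proof.
elim: f => [|a|f IHf g IHg|f IHf g IHg|f IHf g IHg] //=; rewrite ?IHf ?IHg //.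
split=> [[]//|fg]; split=> //.
by case: (pselect (classical_sat T f)) => [/fg|]; [right|left].
Qed.

Lemma classical_sat_reduct W T (f : formula At) :
  classical_sat T (reduct W f) <-> g91_sat W T f.
Proof.
elim: f => [|a|f IHf g IHg|f IHf g IHg|f IHf g IHg|f IHf] //=; rewrite ?IHf ?IHg //.
case: asboolP => [Wf|nWf]; split=> //= Wf; exact: nWf.
Qed.

Lemma there_total_view W : there_view (total_view W) = W.
Proof.
apply/seteqP; split=> T; first by case=> _ [T' WT' <-] <-.
by move=> WT; exists (T, T) => //; exists T.
Qed.

(** A total view equals its own there-view, so the second conjunct of an implication becomes the
    classical one of HT. The value of [L f] does not depend on the evaluation point, which is why a
    constant can replace it. *)
Lemma faeel_sat_total_view W H T (f : formula At) :
  faeel_sat f (total_view W) H T <-> ht_sat H T (reduct W f).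
Proof.
elim: f H T => [|a|f IHf g IHg|f IHf g IHg|f IHf g IHg|f IHf] H T //=;
  rewrite ?there_total_view ?IHf ?IHg //.
- rewrite !ht_sat_total; split=> -[A B]; split=> //; first by case: B.
  by case: (pselect (classical_sat T (reduct W f))) => [/A|]; [right|left].
- have believesE : (forall p, total_view W p -> faeel_sat f (total_view W) p.1 p.2)
      <-> g91_believes W f.
    split=> [A J WJ|A _ [J WJ <-]].
      apply/classical_sat_reduct; rewrite -ht_sat_total -IHf.
      by apply: (A (J, J)); exists J.
    by rewrite IHf ht_sat_total classical_sat_reduct; exact: A.
  rewrite believesE; case: asboolP => [Wf|nWf]; split=> //= _.
  by split=> //; left.
Qed.

Lemma ht_belief_view_total W : W !=set0 -> ht_belief_view (total_view W).
Proof.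
case=> T WT; split; first by exists (T, T); exists T.
by move=> _ [T' _ <-].
Qed.

(** A belief model already tests every pair of its view, so the evaluation point can be moved to any
    of them. *)
Lemma belief_model_view Gamma V H T H' T' :
  belief_model Gamma (BeliefInterp V H T) -> V (H', T') ->
  belief_model Gamma (BeliefInterp V H' T').
Proof.
case=> -[[V0 Vsub] HT] sat VHT'; split; first by split=> //=; exact: Vsub VHT'.
move=> phi Gphi p /= [Vp|->]; first by apply: sat => //; left.
by apply: (sat _ Gphi (H', T')); left.
Qed.

(** The last hypothesis settles the pairs of the view, leaving only the point [(H, T)] to test. *)
Lemma belief_model_total_view Gamma W H T : W !=set0 -> H `<=` T ->
  (forall T', W T' ->
     forall f, subjective_reduct Gamma W f -> classical_sat T' f) ->
  belief_model Gamma (BeliefInterp (total_view W) H T) <->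
  (forall f, subjective_reduct Gamma W f -> ht_sat H T f).
Proof.
move=> W0 HT Wsat; split=> [[_ sat] _ [phi Gphi <-]|sat].
  by apply/faeel_sat_total_view; apply: (sat _ Gphi (H, T)); right.
split; first by split=> //=; exact: ht_belief_view_total.
move=> phi Gphi p /= [[T' WT' <-]|->] /=; apply/faeel_sat_total_view.
  by apply/ht_sat_total; apply: Wsat => //; exists phi.
by apply: sat; exists phi.
Qed.

End ReductCorrespondence.

Theorem theorem3 (At : Type) (Gamma : theory At) (W : set (interp At)) :
  equilibrium_world_view Gamma W -> g91_world_view Gamma W.
Proof.
move=> [[[_ [T0 WT0 _]] _] defW].
have eqbW T : W T -> EQB Gamma (BeliefInterp (total_view W) T T).
  by rewrite {1}defW.
have W0 : W !=set0 by exists T0.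
have Wsat T : W T ->
    forall f, subjective_reduct Gamma W f -> classical_sat T f.
  move=> /eqbW [_ [_ sat] _] _ [phi Gphi <-].
  apply/ht_sat_total/faeel_sat_total_view.
  by apply: (sat _ Gphi (T, T)); right.
apply/seteqP; split=> T.
- move=> WT; split; first exact: Wsat.
  case=> H [[HT nTH] sat]; case: (eqbW T WT) => _ _; apply.
  exists (BeliefInterp (total_view W) H T); split.
    by apply/belief_model_total_view.
  split; last by case=> HeT; apply: nTH; rewrite HeT.
  by split=> //= H' T' WHT; exists H'.
- case=> satT minT; rewrite defW /=; split; first by split=> // _ [T' _ <-].
    apply/belief_model_total_view => // f Gf.
    by apply/ht_sat_total/satT.
  case=> -[V H T'] [modI [[/= eqT HT le1 le2] neqI]]; subst T'.
  have [eqV|neqV] := pselect (V = total_view W).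
    (* With the view unchanged, [neqI] can only come from [H] differing from [T]. *)
    subst V; apply: minT; exists H; split; last first.
      by apply/belief_model_total_view.
    split=> // TH; apply: neqI; congr BeliefInterp.
    by apply/seteqP; split.
  (* The view [V] has a pair [(H0, T0)] over the known world [T0]. Re-rooting there gives a model
     below that of [T0]; it is strictly below because the views differ, even if [H0] equals [T0]. *)
  have [|H0 VH0 H0T0] := le1 T0 T0; first by exists T0.
  case: (eqbW T0 WT0) => _ _; apply.
  exists (BeliefInterp V H0 T0); split; first exact: belief_model_view modI VH0.
  by split; [split|case].
Qed.
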